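(* Let $R$ be a commutative ring, let $s,t\in R$ be units such that $1-st$ is also a unit, and let $X$ be an $R$-module. Let $S:X\times X\to X\times X$ be the bialexander switch $$S(x,y)=S_{s,t}(x,y)=(sy,\ tx+(1-st)y).$$ Let $\tau=(\tau^1,\tau^2):X\times X\to X\times X$ be a bijective map that is left and right invertible. Then $(X,S,\tau)$ is a singular pair if and only if the following hold for all $x,y\in X$: $$\tau(\lambda x,\lambda y)=\lambda\,\tau(x,y)\quad\text{for }\lambda=s,\ t,\ -1,$$ $$\tau(x,y)=\tau(0,\,y-x/s)+(x,\,x/s),$$ $$\tau(x,y)=\tau(x-sy,\,0)+(sy,\,y),$$ $$t\,\tau^1(0,x)=s\,\tau^2(x,0).$$ Moreover, in this case $\tau$ is fully determined by the values $\tau^1(0,x)$, $x\in X$ (that is, if $\tau$ and $\tau'$ both give singular pairs $(X,S,\tau)$, $(X,S,\tau')$ and $\tau^1(0,x)=\tau'^1(0,x)$ for all $x\in X$, then $\tau=\tau'$).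
   Context: For a map $T:X\times X\to X\times X$ write $T(x,y)=(T^1(x,y),T^2(x,y))$. $T$ is left invertible if for any $x,z\in X$ there is a unique $y$ with $T^1(x,y)=z$; it is right invertible if for any $y,w\in X$ there is a unique $x$ with $T^2(x,y)=w$. A biquandle is a pair $(X,S)$, where $S:X\times X\to X\times X$ is a bijection, left and right invertible, satisfying the set-theoretical Yang-Baxter equation $(\mathrm{Id}\times S)(S\times \mathrm{Id})(\mathrm{Id}\times S)=(S\times \mathrm{Id})(\mathrm{Id}\times S)(S\times \mathrm{Id})$, and such that there is a bijection $\mathbf{s}:X\to X$ with $\{(x,y):S(x,y)=(x,y)\}=\{(x,\mathbf{s}(x)):x\in X\}$. (The bialexander switch above is a biquandle.) Given a biquandle $(X,S)$ and a bijective, left and right invertible map $\tau:X\times X\to X\times X$, the triple $(X,S,\tau)$ is called a singular pair if $$\tau\circ S=S\circ\tau,$$ $$(S\times 1)(1\times S)(\tau\times 1)=(1\times \tau)(S\times 1)(1\times S),$$ $$(1\times S)(S\times 1)(1\times \tau)=(\tau\times 1)(1\times S)(S\times 1)$$ as maps $X^3\to X^3$. Here $x/s$ denotes $s^{-1}x$, and addition and scalar multiplication on $X\times X$ are componentwise. *)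

(* Defs.v *)
From mathcomp Require Import all_boot all_algebra.
Set Implicit Arguments.
Unset Strict Implicit.
Unset Printing Implicit Defensive.
Import GRing.Theory.
Local Open Scope ring_scope.

Definition left_invertible (X : Type) (T : X * X -> X * X) : Prop :=
  forall x z : X, exists! y : X, (T (x, y)).1 = z.

Definition right_invertible (X : Type) (T : X * X -> X * X) : Prop :=
  forall y w : X, exists! x : X, (T (x, y)).2 = w.

(* [times_id T] is T x Id and [id_times T] is Id x T; recall that
   X * X * X parses as (X * X) * X. *)
Definition times_id (X : Type) (T : X * X -> X * X) (p : X * X * X) :
    X * X * X :=
  (T p.1, p.2).

Definition id_times (X : Type) (T : X * X -> X * X) (p : X * X * X) :
    X * X * X :=
  let q := T (p.1.2, p.2) in (p.1.1, q.1, q.2).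

Definition yang_baxter (X : Type) (S : X * X -> X * X) : Prop :=
  id_times S \o times_id S \o id_times S
    =1 times_id S \o id_times S \o times_id S.

Definition biquandle (X : Type) (S : X * X -> X * X) : Prop :=
  [/\ bijective S, left_invertible S, right_invertible S, yang_baxter S &
      exists2 f : X -> X, bijective f &
        forall p : X * X, S p = p <-> exists x : X, p = (x, f x)].

Definition singular_pair (X : Type) (S tau : X * X -> X * X) : Prop :=
  [/\ biquandle S,
      [/\ bijective tau, left_invertible tau & right_invertible tau],
      tau \o S =1 S \o tau,
      times_id S \o id_times S \o times_id tau
        =1 id_times tau \o times_id S \o id_times S &
      id_times S \o times_id S \o id_times tau
        =1 times_id tau \o id_times S \o times_id S].

Definition bialexander (R : comPzRingType) (X : lmodType R) (s t : R)
    (p : X * X) : X * X :=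
  (s *: p.2, t *: p.1 + (1 - s * t) *: p.2).

(* Main.v *)
Require Import Defs.
From mathcomp Require Import all_boot all_algebra.
Set Implicit Arguments.
Unset Strict Implicit.
Unset Printing Implicit Defensive.
Import GRing.Theory.
Local Open Scope ring_scope.

(** Write m = 1 - st and S for the bialexander switch. The whole proof consists
    in recognising the maps [tau] of both sides of the equivalence as
      twist A : (x, y) |-> (x + A w, y - t A w)   with w = y - x/s,
    where A : X -> X commutes with the scalars s, t and -1; A is then
    x |-> tau^1 (0, x). The switch S is itself the case A w = s w.

    The mixed relation that moves [tau] past the strand z on the right says that
      tau (t x + m s z, t y + m z) = t tau (x, y) + m (s z, z);
    as t and m are units, this makes [tau] equivariant under the translations by
    vectors (s z, z) ([equivariance_of_braid]), so that [tau] is determined by its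
    restriction to x = 0. The other mixed relation says that [tau] commutes with
    s and preserves the linear form t x + y ([braid_rightE]; here m is cancelled),
    so that tau^2 is determined by tau^1. The two properties together are exactly
    the shape [twist A] ([twist_of_translation]). For a map of that shape, the
    three relations of a singular pair become the commutation of A with
    -st, t and s respectively, and as s and t are units this is commutation with
    s, t and -1 ([twist_of_singular_pair], [singular_pair_of_twist]).

    On the other side, the two translation formulas and t tau^1(0,x) =
    s tau^2(x,0) also force the shape [twist A] ([twist_of_formulas]), and twists
    satisfy these formulas ([twist_formulas]). Uniqueness is immediate, since A is
    the given function x |-> tau^1 (0, x). *)

Section Twist.

Context (R : comPzRingType) (X : lmodType R) (s sinv t : R).
Implicit Types (A : X -> X) (tau : X * X -> X * X).

Local Notation S := (@bialexander R X s t).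

Definition commutes_with (c : R) A := forall x, A (c *: x) = c *: A x.

Definition homogeneous (c : R) tau :=
  forall x y, tau (c *: x, c *: y) = c *: tau (x, y).

(** This is tau (x, y) = (x, y) + (A w, - t A w): the second component is forced
    by the first and by the conservation of t x + y. *)
Definition twist A (p : X * X) : X * X :=
  (p.1 + A (p.2 - sinv *: p.1), p.2 - t *: A (p.2 - sinv *: p.1)).

Definition translation_equivariant tau :=
  forall x y z, tau (x + s *: z, y + z) = tau (x, y) + (s *: z, z).

Definition conservation_law tau :=
  forall x y, t *: (tau (x, y)).1 + (tau (x, y)).2 = t *: x + y.

Lemma scaler_can (a b : R) (x : X) : a * b = 1 -> a *: (b *: x) = x.
Proof. by move=> ab; rewrite scalerA ab scale1r. Qed.

Lemma scaler_inj (a b : R) : a * b = 1 -> injective (fun x : X => b *: x).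
Proof.
by move=> ab; apply: (can_inj (g := fun x => a *: x)) => x; rewrite scaler_can.
Qed.

Lemma twist_homogeneous A (c : R) : commutes_with c A -> homogeneous c (twist A).
Proof.
move=> Ac x y; rewrite /twist /= [sinv *: _]scalerA [sinv * c]mulrC -scalerA.
rewrite -scalerBr Ac; congr pair; first by rewrite scalerDr.
by rewrite scalerBr !scalerA [t * c]mulrC.
Qed.

Lemma twist_conservation A : conservation_law (twist A).
Proof. by move=> x y; rewrite /twist scalerDr addrACA subrr addr0. Qed.

Lemma twist_ext A A' : A =1 A' -> twist A =1 twist A'.
Proof. by move=> eqA p; rewrite /twist eqA. Qed.

Context (s_unit : sinv * s = 1).

Let sK (x : X) : sinv *: (s *: x) = x. Proof. exact: scaler_can. Qed.
Let sVK (x : X) : s *: (sinv *: x) = x.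
Proof. by apply: scaler_can; rewrite mulrC. Qed.

(** * The switch *)

Lemma bialexander_conservation p : t *: (S p).1 + (S p).2 = t *: p.1 + p.2.
Proof.
rewrite /bialexander /= scalerA [t * s]mulrC addrCA -scalerDl.
by rewrite [s * t + _]addrC subrK scale1r.
Qed.

(** S is the twist by multiplication by s; hence the Yang-Baxter equation is an
    instance of [twist_braid_right]. *)
Lemma bialexander_twist : S =1 twist (fun x => s *: x).
Proof.
case=> x y; rewrite /bialexander /twist /= scalerBr sVK [x + _]addrC subrK.
congr pair; rewrite scalerBr opprB scalerBl scale1r scalerA [t * s]mulrC.
exact: addrCA.
Qed.

(** * The three relations for a twist *)

(** On a twist, the parameter w = y - x/s of [S (x, y)] is -st w, which turns
    commutation with S into commutation of A with -st. *)
Lemma twist_commute A :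
  twist A \o S =1 S \o twist A <-> commutes_with (- (s * t)) A.
Proof.
have wS x y : (S (x, y)).2 - sinv *: (S (x, y)).1 = (- (s * t)) *: (y - sinv *: x).
  rewrite /bialexander /= sK scalerBl scale1r addrA addrAC addrK.
  rewrite scalerBr !scaleNr opprK scalerA mulrAC [s * sinv]mulrC s_unit.
  by rewrite mul1r [RHS]addrC.
split=> [comm w | Ast [x y]].
  have /(congr1 fst) := comm (0, w).
  rewrite /= /twist wS /= scaler0 subr0 scalerBr.
  by move/addrI=> ->; rewrite scalerA scaleNr.
have eq1 : (twist A (S (x, y))).1 = (S (twist A (x, y))).1.
  by rewrite /twist wS Ast /= scalerBr scalerA scaleNr.
(* Both sides have the same value of t x + y, so first components suffice. *)
rewrite /comp [LHS]surjective_pairing [RHS]surjective_pairing -eq1; congr pair.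
apply: (addrI (t *: (twist A (S (x, y))).1)).
rewrite twist_conservation bialexander_conservation {1}eq1.
by rewrite bialexander_conservation twist_conservation.
Qed.

(** The first output strand carries s (s z) on both sides, so the relation
    reduces to the other two. *)
Lemma braid_leftE tau :
  times_id S \o id_times S \o times_id tau
    =1 id_times tau \o times_id S \o id_times S <->
  forall x y z, tau (t *: x + (1 - s * t) *: (s *: z), t *: y + (1 - s * t) *: z)
    = t *: tau (x, y) + (1 - s * t) *: (s *: z, z).
Proof.
split=> [braid x y z | braid [[x y] z]].
  have := braid (x, y, z); rewrite /= /times_id /id_times /bialexander /=.
  by case=> e1 e2; rewrite [LHS]surjective_pairing -e1 -e2.
by rewrite /= /times_id /id_times /bialexander /= braid.
Qed.

(** The vectors (s z, z) have w = 0, so on the left of [braid_leftE] the parameter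
    of A is t w. *)
Lemma twist_braid_left A : commutes_with t A ->
  times_id S \o id_times S \o times_id (twist A)
    =1 id_times (twist A) \o times_id S \o id_times S.
Proof.
move=> At; apply/braid_leftE => x y z.
have w : t *: y + (1 - s * t) *: z - sinv *: (t *: x + (1 - s * t) *: (s *: z))
    = t *: (y - sinv *: x).
  rewrite scalerDr [X in _ - (_ + X)]scalerA [sinv * _]mulrC.
  rewrite -[_ *: (s *: z)]scalerA sK.
  by rewrite opprD addrACA subrr addr0 scalerBr !scalerA [sinv * t]mulrC.
rewrite {1}/twist /= w At /twist; congr pair => /=.
  by rewrite scalerDr addrAC.
by rewrite scalerBr addrAC.
Qed.

(** The first two output strands give homogeneity. On the third, t (t x)
    cancels and m times the conservation law at (y, z) remains. *)
Lemma braid_rightE tau (m' : R) : m' * (1 - s * t) = 1 ->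
  id_times S \o times_id S \o id_times tau
    =1 times_id tau \o id_times S \o times_id S <->
  homogeneous s tau /\ conservation_law tau.
Proof.
move=> m_unit; split=> [braid | [tau_s cons] [[x y] z]].
  split=> y z; have := braid (0, y, z).
    rewrite /= /times_id /id_times /bialexander /=.
    by case=> eq_tau _; exact: esym eq_tau.
  rewrite /= /times_id /id_times /bialexander /= scaler0 !add0r.
  case=> _; rewrite !scalerA [t * _]mulrC -!scalerA -!scalerDr.
  exact: (scaler_inj m_unit).
rewrite /= /times_id /id_times /bialexander /= tau_s; congr (_, _, _).
rewrite !scalerDr -!addrA; congr (_ + _).
by rewrite !scalerA [t * _]mulrC -!scalerA -!scalerDr cons.
Qed.

(** At A w = s w, where the twist is S, this is the Yang-Baxter equation. *)
Lemma twist_braid_right A (m' : R) : m' * (1 - s * t) = 1 -> commutes_with s A ->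
  id_times S \o times_id S \o id_times (twist A)
    =1 times_id (twist A) \o id_times S \o times_id S.
Proof.
move=> m_unit As; apply/(braid_rightE _ m_unit); split; last exact: twist_conservation.
exact: twist_homogeneous.
Qed.

(** * Maps of twist shape *)

(** A translation by a vector (s z, z) brings any (x, y) to the line x = 0, and
    there the conservation law gives the second component from the first. *)
Lemma twist_of_translation tau :
  translation_equivariant tau -> conservation_law tau ->
  tau =1 twist (fun x => (tau (0, x)).1).
Proof.
move=> trans cons [x y]; have := trans 0 (y - sinv *: x) (sinv *: x).
rewrite add0r subrK sVK => eq_tau; have eq1 := congr1 fst eq_tau.
rewrite [LHS]surjective_pairing; congr pair; first by rewrite eq1 /= addrC.
apply: (addrI (t *: (tau (x, y)).1)).
by rewrite cons {1}eq1 /= scalerDr [_ + t *: x]addrC addrACA subrr addr0.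
Qed.

(** Setting z = 0 in [braid_leftE] gives homogeneity in t; x, y and z may then be
    divided by the units t, t and m. *)
Lemma equivariance_of_braid tau (t' m' : R) : t' * t = 1 -> m' * (1 - s * t) = 1 ->
  times_id S \o id_times S \o times_id tau
    =1 id_times tau \o times_id S \o id_times S ->
  homogeneous t tau /\ translation_equivariant tau.
Proof.
move=> t_unit m_unit /braid_leftE braid.
have m_can (x : X) : (1 - s * t) *: (m' *: x) = x.
  by apply: scaler_can; rewrite mulrC.
have tau_t : homogeneous t tau.
  move=> x y; by have := braid x y 0; rewrite !scaler0 !addr0.
have t_can (x : X) : t *: (t' *: x) = x by apply: scaler_can; rewrite mulrC.
split=> // x y z.
have := braid (t' *: x) (t' *: y) (m' *: z).
rewrite -tau_t !t_can.
rewrite [s *: _]scalerA [s * m']mulrC -scalerA.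
rewrite !m_can => ->; congr (_ + _).
by rewrite -[LHS]/(_ *: _, _ *: _) !m_can.
Qed.

(** Fixed points satisfy x = s y, whence the bijection x |-> x/s. *)
Lemma bialexander_biquandle (t' m' : R) : t' * t = 1 -> m' * (1 - s * t) = 1 ->
  biquandle S.
Proof.
move=> t_unit m_unit.
have t_can (x : X) : t *: (t' *: x) = x by apply: scaler_can; rewrite mulrC.
split.
- pose T (p : X * X) := (t' *: (p.2 - (1 - s * t) *: (sinv *: p.1)), sinv *: p.1).
  exists T => [[x y] | [x y]]; rewrite /T /bialexander /=.
    by rewrite sK addrK (scaler_can _ t_unit).
  by rewrite t_can sVK subrK.
- move=> x z; exists (sinv *: z); split=> [|y' /= <-]; first by rewrite /= sVK.
  by rewrite sK.
- move=> y w; exists (t' *: (w - (1 - s * t) *: y)); split=> [|x /= <-].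
    by rewrite /= t_can subrK.
  by rewrite addrK (scaler_can _ t_unit).
- move=> p; have eqS : id_times S =1 id_times (twist (fun x => s *: x)).
    by move=> q; rewrite /id_times bialexander_twist.
  have eqS' : times_id S =1 times_id (twist (fun x => s *: x)).
    by move=> q; rewrite /times_id bialexander_twist.
  rewrite /= [id_times S p]eqS [RHS]eqS'.
  by apply: (twist_braid_right m_unit) => x.
- exists (fun x => sinv *: x); first by exists (fun x => s *: x).
  case=> x y; split=> [[<- _] | [z [-> ->]]]; first by exists (s *: y); rewrite sK.
  rewrite /bialexander /= sVK; congr pair.
  by rewrite scalerBl scale1r mulrC -scalerA sVK addrC subrK.
Qed.

(** * Singular pairs and formulas as twists *)

Lemma twist_of_singular_pair tau (t' m' : R) :
  t' * t = 1 -> m' * (1 - s * t) = 1 -> singular_pair S tau ->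
  let A x := (tau (0, x)).1 in
  [/\ tau =1 twist A, commutes_with s A, commutes_with t A & commutes_with (-1) A].
Proof.
move=> t_unit m_unit [_ _ comm braid_l braid_r] A.
have [tau_t trans] := equivariance_of_braid t_unit m_unit braid_l.
have [tau_s cons] := (braid_rightE tau m_unit).1 braid_r.
have eq_tau := twist_of_translation trans cons.
have homog c : homogeneous c tau -> commutes_with c A.
  move=> tau_c x; rewrite /A -[in LHS](scaler0 X c).
  by rewrite tau_c.
have As := homog _ tau_s; have At := homog _ tau_t; split=> // x.
have Ast : commutes_with (- (s * t)) A.
  by apply/twist_commute => p; rewrite /= -!eq_tau; exact: comm.
(* On multiples of st, commutation with -1 follows from that with s, t and -st;
   st being a unit, every element is such a multiple. *)
have <- : s *: (t *: (t' *: (sinv *: x))) = x.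
  by rewrite [t *: _]scaler_can ?sVK // mulrC.
move: (t' *: _) => u; rewrite As At !scalerA mulN1r mulNr; exact: Ast.
Qed.

Lemma singular_pair_of_twist tau A (t' m' : R) :
  t' * t = 1 -> m' * (1 - s * t) = 1 ->
  bijective tau -> left_invertible tau -> right_invertible tau ->
  tau =1 twist A ->
  commutes_with s A -> commutes_with t A -> commutes_with (-1) A ->
  singular_pair S tau.
Proof.
move=> t_unit m_unit tau_bij tau_left tau_right eq_tau As At An.
have eq_l : times_id tau =1 times_id (twist A).
  by move=> p; rewrite /times_id eq_tau.
have eq_r : id_times tau =1 id_times (twist A).
  by move=> p; rewrite /id_times eq_tau.
split=> //; first exact: bialexander_biquandle t_unit m_unit.
- move=> p; rewrite /= !eq_tau; apply: (twist_commute A).2 => x.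
  by rewrite -[- _]mulN1r -!scalerA An As At.
- by move=> p; rewrite /= eq_l eq_r; exact: twist_braid_left.
- by move=> p; rewrite /= eq_l eq_r; exact: (twist_braid_right m_unit).
Qed.

(** The second translation formula at (0, w), with homogeneity in s and -1, gives
    tau^2 (0, w) = w - s tau^2 (w, 0), and the last formula turns the right-hand
    side into w - t tau^1 (0, w), the second component of a twist. The first
    translation formula extends this from x = 0 to all x. *)
Lemma twist_of_formulas tau :
  homogeneous s tau -> homogeneous (-1) tau ->
  (forall x y, tau (x, y) = tau (0, y - sinv *: x) + (x, sinv *: x)) ->
  (forall x y, tau (x, y) = tau (x - s *: y, 0) + (s *: y, y)) ->
  (forall x, t *: (tau (0, x)).1 = s *: (tau (x, 0)).2) ->
  tau =1 twist (fun x => (tau (0, x)).1).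
Proof.
move=> tau_s tau_n trans0 trans1 tau_st.
have tau0 w : (tau (0, w)).2 = w - t *: (tau (0, w)).1.
  have := tau_n (s *: w) 0; rewrite scaler0 scaleN1r => tau_nw.
  have := tau_s w 0; rewrite scaler0 => tau_sw.
  by rewrite tau_st trans1 sub0r tau_nw tau_sw scaleN1r addrC.
case=> x y; rewrite trans0 [LHS]surjective_pairing /twist /= tau0.
by rewrite addrC addrAC subrK.
Qed.

Lemma twist_formulas A :
  commutes_with s A -> commutes_with (-1) A ->
  [/\ forall x y, twist A (x, y) = twist A (0, y - sinv *: x) + (x, sinv *: x),
      forall x y, twist A (x, y) = twist A (x - s *: y, 0) + (s *: y, y) &
      forall x, t *: (twist A (0, x)).1 = s *: (twist A (x, 0)).2].
Proof.
move=> As An; split=> [x y | x y | x]; rewrite /twist /=.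
- rewrite !scaler0 !subr0; congr pair; first by rewrite /= add0r addrC.
  by rewrite /= addrAC subrK.
- rewrite !sub0r scalerBr sK opprB; congr pair => /=.
    by rewrite addrAC subrK.
  by rewrite addrC.
- rewrite scaler0 subr0 add0r !sub0r -[- (sinv *: x)]scaleN1r An scaleN1r.
  by rewrite !scalerN opprK scalerA mulrC -scalerA -As sVK.
Qed.

End Twist.

Theorem theorem16 (R : comPzRingType) (X : lmodType R) (s sinv t : R)
    (s_unit : sinv * s = 1)
    (t_unit : exists u : R, u * t = 1)
    (st_unit : exists u : R, u * (1 - s * t) = 1)
    (tau : X * X -> X * X)
    (tau_bij : bijective tau)
    (tau_left : left_invertible tau)
    (tau_right : right_invertible tau) :
  (singular_pair (bialexander s t) tau <->
    [/\ forall lambda : R, lambda \in [:: s; t; -1] ->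
          forall x y : X,
            tau (lambda *: x, lambda *: y) = lambda *: tau (x, y),
        forall x y : X,
          tau (x, y) = tau (0, y - sinv *: x) + (x, sinv *: x),
        forall x y : X,
          tau (x, y) = tau (x - s *: y, 0) + (s *: y, y) &
        forall x : X, t *: (tau (0, x)).1 = s *: (tau (x, 0)).2]) /\
  (singular_pair (bialexander s t) tau ->
    forall tau' : X * X -> X * X,
      singular_pair (bialexander s t) tau' ->
      (forall x : X, (tau (0, x)).1 = (tau' (0, x)).1) ->
      tau =1 tau').
Proof.
have [[t' t'K] [m' m'K]] := (t_unit, st_unit).
split; last first.
  move=> pair_tau tau' pair_tau' eqA p.
  have [-> _ _ _] := twist_of_singular_pair s_unit t'K m'K pair_tau.
  have [-> _ _ _] := twist_of_singular_pair s_unit t'K m'K pair_tau'.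
  exact: twist_ext.
split=> [pair_tau | [homog trans0 trans1 tau_st]].
  have [eq_tau As At An] := twist_of_singular_pair s_unit t'K m'K pair_tau.
  have [trans0 trans1 tau_st] := twist_formulas t s_unit As An.
  split=> [c c_in x y | x y | x y | x]; rewrite ?eq_tau; last 3 first.
  - exact: trans0.
  - exact: trans1.
  - exact: tau_st.
  apply: twist_homogeneous.
  by move: c_in; rewrite !inE => /or3P[] /eqP->.
have commutes c : c \in [:: s; t; -1] ->
    commutes_with c (fun x => (tau (0, x)).1).
  by move=> c_in x; rewrite -[in LHS](scaler0 _ c) homog.
apply: (singular_pair_of_twist (A := fun x => (tau (0, x)).1) s_unit t'K m'K) => //.
- apply: (twist_of_formulas (s := s)) => // x y; apply: homog.
    by rewrite !inE eqxx.
  by rewrite !inE eqxx !orbT.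
- by apply: commutes; rewrite !inE eqxx.
- by apply: commutes; rewrite !inE eqxx orbT.
- by apply: commutes; rewrite !inE eqxx !orbT.
Qed.
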